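(* For all integers $p\ge2$, $r\ge0$ and $1\le s\le k\le n$, $$\sum_{j=s}^{n-k+s}\frac{ps}{(p+1)j-s}\binom{(p+1)j-s}{j-s}\,\frac{(p-1)(n-j)+k-s+r+1}{p(n-j)+r+1}\binom{(p+1)(n-j)+r-k+s}{p(n-j)+r}=\frac{(p-1)n+k+r+1}{pn+r+1}\binom{(p+1)n+r-k}{pn+r}.$$ *)

(* Defs.v *)
From mathcomp Require Import all_boot all_order all_algebra.

(* Main.v *)
Require Import Defs.
From mathcomp Require Import all_boot all_order all_algebra.
From mathcomp Require Import ring zify.
Import Order.TTheory GRing.Theory Num.Theory.
Local Open Scope ring_scope.

(** Put [q = p + 1], [j = s + i] and [N = n - k].  The first factor is the
    coefficient of [x^i] in [B^(ps)], where [B = 1 + x B^q], and the second one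
    is [D_m(a) - D_(m-1)(a + q)] with [m = N - i], [a = p (k - s) + r] and
    [D_m(a) = 'C(a + q m, m)].  The right-hand side is the same difference at
    [m = N] and [a = p k + r], so the identity is the difference of two
    instances of the Rothe-Hagen convolution
    [\sum_i [x^i]B^c * D_(N-i)(a) = D_N(a + c)].  The latter follows by induction
    on [N] and then on [c], since both [[x^i]B^c] and [D_i(c)] satisfy
    [f_(i+1)(c + 1) = f_(i+1)(c) + f_i(c + q)]. *)

(* [rothe p c i] equals [c / (c + q i) * 'C(c + q i, i)] with [q = p + 1]; in
   this form no denominator vanishes, even when [c = 0]. *)
Definition rothe (p c i : nat) : rat :=
  if i is i'.+1 then c%:R / i'.+1%:R * 'C(c + p.+1 * i' + p, i')%:R else 1.

Definition dilated_bin (p a m : nat) : rat := 'C(a + p.+1 * m, m)%:R.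

Definition dilated_ballot (p a m : nat) : rat :=
  dilated_bin p a m - (if m is m'.+1 then dilated_bin p (a + p.+1) m' else 0).

(** For [i > 0], Pascal's rule and [(i+1) 'C(X, i+1) = (X-i) 'C(X, i)] turn every term into a
    rational multiple of one binomial. *)
Lemma rothe_recS p c i :
  rothe p c.+1 i.+1 = rothe p c i.+1 + rothe p (c + p.+1) i.
Proof.
case: i => [|i]; first by rewrite /rothe !bin0 !divr1 /= -natr1.
rewrite /rothe.
have -> : (c.+1 + p.+1 * i.+1 + p = (c + p.+1 * i.+1 + p).+1)%N by lia.
have -> : (c + p.+1 + p.+1 * i + p = c + p.+1 * i.+1 + p)%N by lia.
have := mul_bin_left (c + p.+1 * i.+1 + p) i.
rewrite binS; set X := (c + _ + p)%N => /(congr1 (fun x : nat => x%:R : rat)).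
rewrite !natrM natrB; last by rewrite /X; lia.
rewrite natrD.
have -> : X%:R = c%:R + (p%:R + 1) * (i%:R + 1) + p%:R :> rat.
  by rewrite /X !natrD natrM -!natr1.
set u := 'C(_, _)%:R; set v := 'C(_, _)%:R; rewrite -!natr1 natrD -!natr1.
move=> E.
have i1 : i%:R + 1 != 0 :> rat by rewrite natr1 pnatr_eq0.
have i2 : i%:R + 1 + 1 != 0 :> rat by rewrite !natr1 pnatr_eq0.
have -> : u = (c%:R + (p%:R + 1) * (i%:R + 1) + p%:R - i%:R) * v / (i%:R + 1).
  by rewrite -E mulrC mulKf.
by field; rewrite i1 i2.
Qed.

Lemma dilated_bin_recS p a m :
  dilated_bin p a.+1 m.+1 = dilated_bin p a m.+1 + dilated_bin p (a + p.+1) m.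
Proof. by rewrite /dilated_bin addSn binS natrD mulnS addnA. Qed.

Lemma rothe_hagen p c a N :
  \sum_(i < N.+1) rothe p c i * dilated_bin p a (N - i) = dilated_bin p (a + c) N.
Proof.
elim: N c => [|N IHN] c; first by rewrite big_ord1 /rothe /dilated_bin !bin0 mulr1.
elim: c => [|c IHc].
  rewrite big_ord_recl big1 ?addr0 ?addn0 ?mul1r // => i _.
  by rewrite /rothe /= !mul0r.
(* [IHN] is used at [c + p.+1], hence the outer induction keeps [c] general. *)
rewrite addnS dilated_bin_recS -IHc -addnA -IHN.
rewrite big_ord_recl [in RHS]big_ord_recl -addrA; congr (_ + _).
rewrite -big_split; apply: eq_bigr => i _.
by rewrite !lift0 rothe_recS mulrDl subSS.
Qed.

Lemma rothe_ballot_convolution p c a N :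
  \sum_(i < N.+1) rothe p c i * dilated_ballot p a (N - i)
  = dilated_ballot p (a + c) N.
Proof.
rewrite {2}/dilated_ballot -rothe_hagen.
under eq_bigr => i _ do rewrite mulrBr.
rewrite sumrB; congr (_ - _).
case: N => [|N]; first by rewrite big_ord1 mulr0.
(* The last subtracted term falls on the default [0] of [dilated_ballot]; the others form the
   convolution at [N] and [a + p.+1]. *)
rewrite big_ord_recr /= subnn mulr0 addr0 addnAC -rothe_hagen.
by apply: eq_bigr => i _; rewrite subSn // -ltnS.
Qed.

(** Absorption, [(X+1) 'C(X, i) = (i+1) 'C(X+1, i+1)]; at [i = 0] the quotient is [c / c]. *)
Lemma rotheE p c i : (0 < c)%N ->
  rothe p c i = c%:R / (c + p.+1 * i)%:R * 'C(c + p.+1 * i, i)%:R.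
Proof.
move=> c0; case: i => [|i].
  by rewrite muln0 addn0 bin0 mulr1 divff // pnatr_eq0 -lt0n.
rewrite /rothe.
have -> : (c + p.+1 * i.+1 = (c + p.+1 * i + p).+1)%N by lia.
set X := (c + _ + p)%N.
have := mul_bin_diag X.+1 i => /(congr1 (fun x : nat => x%:R : rat)).
rewrite !natrM => E.
have X1 : X.+1%:R != 0 :> rat by rewrite pnatr_eq0.
have -> : 'C(X, i)%:R = i.+1%:R * 'C(X.+1, i.+1)%:R / X.+1%:R :> rat.
  by rewrite -E mulrC mulKf.
by field; rewrite !nat1r !pnatr_eq0.
Qed.

(** Both binomials have upper index [M = a + p.+1 * m], and ['C(M, m-1) = m / (p m + a + 1) * 'C(M,
    m)]. *)
Lemma dilated_ballotE p a m : (0 < p)%N ->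
  dilated_ballot p a m = ((p%:R - 1) * m%:R + a%:R + 1) / (p%:R * m%:R + a%:R + 1)
                         * 'C(a + p.+1 * m, m)%:R.
Proof.
move=> p0.
have d0 : p%:R * m%:R + a%:R + 1 != 0 :> rat.
  by rewrite -natrM -natrD natr1 pnatr_eq0.
case: m d0 => [|m] d0; rewrite /dilated_ballot /dilated_bin.
  by rewrite subr0 !mulr0 !add0r divff ?mul1r // natr1 pnatr_eq0.
have -> : (a + p.+1 + p.+1 * m = a + p.+1 * m.+1)%N by lia.
have := mul_bin_left (a + p.+1 * m.+1) m => /(congr1 (fun x : nat => x%:R : rat)).
rewrite !natrM.
have -> : (a + p.+1 * m.+1 - m = p * m.+1 + a + 1)%N by lia.
rewrite !natrD natrM => E.
have -> : 'C(a + p.+1 * m.+1, m)%:R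
  = m.+1%:R * 'C(a + p.+1 * m.+1, m.+1)%:R / (p%:R * m.+1%:R + a%:R + 1) :> rat.
  by rewrite E mulrC mulKf.
by move: (m.+1%:R : rat) d0 => y d0; field.
Qed.

Theorem mainTheorem4 (p r s k n : nat)
    (hp : (2 <= p)%N) (hs : (1 <= s)%N) (hsk : (s <= k)%N) (hkn : (k <= n)%N) :
  \sum_(s <= j < (n - k + s).+1)
     ((p%:R * s%:R) / ((p%:R + 1) * j%:R - s%:R)
      * 'C((p + 1) * j - s, j - s)%:R
      * (((p%:R - 1) * (n%:R - j%:R) + k%:R - s%:R + r%:R + 1)
         / (p%:R * (n%:R - j%:R) + r%:R + 1))
      * 'C((p + 1) * (n - j) + r + s - k, p * (n - j) + r)%:R)
  = ((p%:R - 1) * n%:R + k%:R + r%:R + 1) / (p%:R * n%:R + r%:R + 1)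
    * 'C((p + 1) * n + r - k, p * n + r)%:R :> rat.
Proof.
have p0 : (0 < p)%N by lia.
have [N defn] : exists N, n = (N + k)%N by exists (n - k)%N; rewrite subnK.
have [d defk] : exists d, k = (d + s)%N by exists (k - s)%N; rewrite subnK.
have -> : ((p%:R - 1) * n%:R + k%:R + r%:R + 1) / (p%:R * n%:R + r%:R + 1)
    * 'C((p + 1) * n + r - k, p * n + r)%:R
  = dilated_ballot p (p * d + r + p * s) N :> rat.
  rewrite dilated_ballotE //.
  have -> : ((p + 1) * n + r - k = p * d + r + p * s + p.+1 * N)%N by lia.
  (* Symmetry of binomials trades the lower index [N] for [p * n + r]. *)
  rewrite -[in RHS]bin_sub; last by lia.
  have -> : (p * d + r + p * s + p.+1 * N - N = p * n + r)%N by lia.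
  by congr (_ / _ * _); rewrite defn defk !natrD !natrM; ring.
(* The convolution is taken at [c = p * s], and the sum is reindexed by [j = i + s]. *)
rewrite -rothe_ballot_convolution -{1}[s]add0n big_addn.
have -> : ((n - k + s).+1 - s = N.+1)%N by lia.
rewrite big_mkord; apply: eq_bigr => i _.
have iN : (i <= N)%N by rewrite -ltnS.
rewrite rotheE ?muln_gt0 ?p0 // dilated_ballotE // -mulrA.
have -> : ((p + 1) * (i + s) - s = p * s + p.+1 * i)%N by lia.
have -> : ((p + 1) * (n - (i + s)) + r + s - k
           = p * d + r + p.+1 * (N - i))%N by nia.
rewrite -[in RHS](bin_sub (n := p * d + r + _)); last by nia.
have -> : (p * d + r + p.+1 * (N - i) - (N - i) = p * (n - (i + s)) + r)%N by nia.
rewrite addnK; congr (_ / _ * _ * (_ / _ * _)); rewrite ?natrD ?natrM -?natr1 ?natrB //.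
- by ring.
- by rewrite defn defk !natrD; ring.
- by rewrite defn defk !natrD; ring.
Qed.
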